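(* Let $G$ be an acyclic ADT network over $\mathbb F_q$, and let $S$, $T$ be a source supernode and a destination supernode. Let $M=A(I-F)^{-1}B^T$ be the system matrix from the source processes $\mathcal X(S)$ to the destination outputs $\mathcal Z(T)$, viewed as a function of the coding coefficients. Then $$\mathrm{mincut}(S,T)=\min_{\Omega}\mathrm{rank}(G_\Omega)=\max_{\alpha,\beta,\epsilon}\mathrm{rank}(M).$$
   Context: ADT network model. $G=(\mathcal V,\mathcal E)$ is a directed acyclic network of supernodes $V$. Each supernode has input ports $I(V)$ and output ports $O(V)$, and edges go from output ports of one supernode to input ports of another. Linear coding over $\mathbb F_q$ works as follows. - The source $S$ has source processes $X(S,1),\dots,X(S,\mu(S))$. - An output port $e\in O(V)$ carries $Y(e)=\sum_{e'\in I(V)}\beta_{(e',e)}Y(e')$. At the source, $\sum_i\alpha_{(i,e)}X(S,i)$ is added. - An output port sends the same symbol on all of its outgoing edges. - An input port $e'$ receives $Y(e')=\sum_{(e,e')\in\mathcal E}Y(e)$, the sum taken over $\mathbb F_q$. - $T$ outputs $Z(T,k)=\sum_{e'\in I(T)}\epsilon_{(e',(T,k))}Y(e')$ for $k=1,\dots,\nu(T)$. Index the ports as $e_1,\dots,e_m$. The matrix $F$ is $m\times m$, with $F_{i,j}=1$ if $(e_i,e_j)\in\mathcal E$, $F_{i,j}=\beta_{(e_i,e_j)}$ if $e_i,e_j$ are an input and an output port of the same supernode, and $F_{i,j}=0$ otherwise. The matrix $A$ is $\mu(S)\times m$, with $A_{i,j}=\alpha_{(i,e_j)}$ for $e_j\in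 O(S)$ and $0$ otherwise. The matrix $B$ is $\nu(T)\times m$, with $B_{k,i}=\epsilon_{(e_i,(T,k))}$ for $e_i\in I(T)$ and $0$ otherwise. Then $\mathcal Z(T)=\mathcal X(S)M$ with $M=A(I-F)^{-1}B^T$. A cut is a partition $\mathcal V=\Omega\cup\Omega^c$ with $S\in\Omega$ and $T\in\Omega^c$. $G_\Omega$ is the $0$-$1$ incidence matrix of the bipartite graph formed by the edges from output ports of supernodes in $\Omega$ to input ports of supernodes in $\Omega^c$. $\mathrm{mincut}(S,T)$ denotes the ADT capacity $\min_\Omega\mathrm{rank}(G_\Omega)$.
   Formalization: The formal theorem assumes that μ(S) and ν(T) are both at least mincut(S,T), which is necessary because rank(M) ≤ min(μ(S), ν(T)), and that S and T are distinct, so that a cut exists. *)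

(* Defs.v *)
From HB Require Import structures.
From mathcomp Require Import all_boot all_order all_algebra.
Set Implicit Arguments. Unset Strict Implicit. Unset Printing Implicit Defensive.
Import GRing.Theory.
Local Open Scope ring_scope.

(* An ADT network: supernodes of a finite type V, ports e_1..e_m indexed by
   'I_m, each port owned by a supernode [own] and being an output port
   ([isout = true]) or an input port ([isout = false]); [E] is the edge
   relation between ports. *)

Definition adt_edges_ok (V : finType) (m : nat) (own : 'I_m -> V)
  (isout : 'I_m -> bool) (E : rel 'I_m) : Prop :=
  forall e e', E e e' -> [&& isout e, ~~ isout e' & own e != own e'].

Definition adt_node_rel (V : finType) (m : nat) (own : 'I_m -> V)
  (E : rel 'I_m) : rel V :=
  fun u v => [exists e, exists e', [&& E e e', own e == u & own e' == v]].

Definition adt_acyclic (V : finType) (m : nat) (own : 'I_m -> V)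
  (E : rel 'I_m) : Prop :=
  forall u v, adt_node_rel own E u v -> ~~ connect (adt_node_rel own E) v u.

Definition adt_A (F : fieldType) (V : finType) (m mu : nat) (own : 'I_m -> V)
  (isout : 'I_m -> bool) (S : V) (alpha : 'M[F]_(mu, m)) : 'M[F]_(mu, m) :=
  \matrix_(i, j) (if isout j && (own j == S) then alpha i j else 0).

Definition adt_F (F : fieldType) (V : finType) (m : nat) (own : 'I_m -> V)
  (isout : 'I_m -> bool) (E : rel 'I_m) (beta : 'M[F]_m) : 'M[F]_m :=
  \matrix_(i, j)
    (if E i j then 1
     else if [&& ~~ isout i, isout j & own i == own j] then beta i j else 0).

Definition adt_B (F : fieldType) (V : finType) (m nu : nat) (own : 'I_m -> V)
  (isout : 'I_m -> bool) (T : V) (eps : 'M[F]_(nu, m)) : 'M[F]_(nu, m) :=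
  \matrix_(k, i) (if ~~ isout i && (own i == T) then eps k i else 0).

Definition adt_M (F : fieldType) (V : finType) (m mu nu : nat)
  (own : 'I_m -> V) (isout : 'I_m -> bool) (E : rel 'I_m) (S T : V)
  (alpha : 'M[F]_(mu, m)) (beta : 'M[F]_m) (eps : 'M[F]_(nu, m))
  : 'M[F]_(mu, nu) :=
  adt_A own isout S alpha *m invmx (1%:M - adt_F own isout E beta)
    *m (adt_B own isout T eps)^T.

(* G_Omega: 0-1 incidence matrix of edges from output ports of supernodes in
   Omega to input ports of supernodes outside Omega.  It is represented as an
   m x m matrix (rows/columns indexed by all ports); rows/columns of ports not
   in the bipartite graph are zero, which does not change the rank. *)
Definition adt_GOmega (F : fieldType) (V : finType) (m : nat)
  (own : 'I_m -> V) (isout : 'I_m -> bool) (E : rel 'I_m) (Om : {set V})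
  : 'M[F]_m :=
  \matrix_(i, j)
    (if [&& E i j, isout i, own i \in Om, ~~ isout j & own j \notin Om]
     then 1 else 0).

(* mincut(S,T) = min over cuts Omega (S in Omega, T not in Omega) of
   rank(G_Omega).  (The default value m is irrelevant when S != T, since then
   the set of cuts is nonempty.) *)
Definition adt_mincut (F : fieldType) (V : finType) (m : nat)
  (own : 'I_m -> V) (isout : 'I_m -> bool) (E : rel 'I_m) (S T : V) : nat :=
  \big[minn/m]_(Om : {set V} | (S \in Om) && (T \notin Om))
     \rank (adt_GOmega F own isout E Om).

(* Main.v *)
Require Import Defs.
From HB Require Import structures.
From mathcomp Require Import all_boot all_order all_algebra.
From mathcomp Require Import zify.
Import GRing.Theory.
Local Open Scope ring_scope.

Set Implicit Arguments.
Unset Strict Implicit.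

(* The bound by cuts is a factorization of [M] through [G_Om].  Conversely,
   eliminating [(1 - F)^-1] turns the rank of its block with rows in [O(S)] and
   columns in [I(T)] into the rank of the matrix [1 - F] with the rows [I(T)]
   and the columns [O(S)] deleted.  Its entries are constants, except for the
   free coefficients [beta], which fill complete bipartite blocks
   [I(v) x O(v)].  A min-max theorem for such completions, valid over every
   field because each coefficient occurs in a single entry, gives the largest
   rank as a minimum over covers of the free positions by rows and columns;
   a cover takes all of [I(v)] or all of [O(v)] for each supernode [v], which
   is a choice of a cut. *)

(** * Coordinate projections *)

(** Rows and columns are deleted by zeroing them, so that every block stays an [m] by [m] matrix. *)
Definition coord_proj (F : fieldType) (m : nat) (I : {set 'I_m}) : 'M[F]_m :=
  diag_mx (\row_j (j \in I)%:R).

Lemma coord_projE (F : fieldType) (m : nat) (I : {set 'I_m}) i j :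
  coord_proj F I i j = ((i == j) && (i \in I))%:R.
Proof. by rewrite !mxE; case: eqP => [->|]; rewrite ?mulr1n ?mulr0n. Qed.

Lemma coord_projMlE (F : fieldType) (m n : nat) (I : {set 'I_m})
    (A : 'M[F]_(m, n)) i j :
  (coord_proj F I *m A) i j = if i \in I then A i j else 0.
Proof. by rewrite mul_diag_mx !mxE; case: ifP; rewrite ?mul1r ?mul0r. Qed.

Lemma coord_projMrE (F : fieldType) (m n : nat) (I : {set 'I_m})
    (A : 'M[F]_(n, m)) i j :
  (A *m coord_proj F I) i j = if j \in I then A i j else 0.
Proof. by rewrite mul_mx_diag !mxE; case: ifP; rewrite ?mulr1 ?mulr0. Qed.

Lemma coord_proj_mul (F : fieldType) (m : nat) (I J : {set 'I_m}) :
  coord_proj F I *m coord_proj F J = coord_proj F (I :&: J).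
Proof.
apply/matrixP=> i j; rewrite coord_projMlE !coord_projE inE.
by case: (i \in I); rewrite ?andbF.
Qed.

Lemma coord_proj0 (F : fieldType) (m : nat) : coord_proj F (set0 : {set 'I_m}) = 0.
Proof. by apply/matrixP=> i j; rewrite coord_projE inE andbF mxE. Qed.

Lemma coord_proj_setC (F : fieldType) (m : nat) (I : {set 'I_m}) :
  coord_proj F I + coord_proj F (~: I) = 1%:M.
Proof.
apply/matrixP=> i j; rewrite mxE !coord_projE inE mxE.
by case: (i \in I); case: (i == j); rewrite /= ?addr0 ?add0r.
Qed.

Lemma coord_proj_subP (F : fieldType) (m n p : nat) (I : {set 'I_m})
    (A : 'M[F]_(m, n)) (U : 'M[F]_(p, n)) :
  reflect (forall i, i \in I -> (row i A <= U)%MS) (coord_proj F I *m A <= U)%MS.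
Proof.
have rowE i : row i (coord_proj F I *m A) = if i \in I then row i A else 0.
  by apply/rowP=> j; rewrite mxE coord_projMlE; case: ifP; rewrite mxE.
apply: (iffP row_subP) => sAU i; first by move=> Ii; have:= sAU i; rewrite rowE Ii.
by rewrite rowE; case: ifP => [/sAU|_]; rewrite ?sub0mx.
Qed.

Lemma row_coord_proj_sub (F : fieldType) (m n : nat) (I : {set 'I_m})
    (A : 'M[F]_(m, n)) i :
  i \in I -> (row i A <= coord_proj F I *m A)%MS.
Proof. by move=> Ii; apply: (coord_proj_subP I A _ (submx_refl _)). Qed.

Lemma coord_proj_subl (F : fieldType) (m n : nat) (I J : {set 'I_m})
    (A : 'M[F]_(m, n)) :
  I \subset J -> (coord_proj F I *m A <= coord_proj F J *m A)%MS.
Proof.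
by move=> /subsetP sIJ; apply/coord_proj_subP => i /sIJ; apply: row_coord_proj_sub.
Qed.

Lemma coord_proj_sub_setU (F : fieldType) (m n : nat) (I J : {set 'I_m})
    (A : 'M[F]_(m, n)) :
  (coord_proj F (I :|: J) *m A <= coord_proj F I *m A + coord_proj F J *m A)%MS.
Proof.
apply/coord_proj_subP => i /setUP[] Ii; apply: submx_trans (row_coord_proj_sub A Ii) _.
  exact: addsmxSl.
exact: addsmxSr.
Qed.

(** The projections for [I] and its complement have ranks at most the cardinalities, and these ranks
    sum to at least [m]. *)
Lemma rank_coord_proj (F : fieldType) (m : nat) (I : {set 'I_m}) :
  \rank (coord_proj F I) = #|I|.
Proof.
have le_card (J : {set 'I_m}) : (\rank (coord_proj F J) <= #|J|)%N.
  suff sJ : (coord_proj F J <= \sum_(i in J) <<delta_mx 0 i : 'rV_m>>)%MS.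
    apply: leq_trans (mxrankS sJ) (leq_trans (mxrank_sum_leqif _).1 _) => /=.
    by rewrite -sum1_card; apply: leq_sum => i _; rewrite genmxE rank_leq_row.
  rewrite -[coord_proj F J]mulmx1; apply/coord_proj_subP=> i Ji.
  by rewrite row1 (sumsmx_sup i) ?genmxE.
have : (m <= \rank (coord_proj F I) + \rank (coord_proj F (~: I)))%N.
  by rewrite -[leqLHS](mxrank1 F) -(coord_proj_setC F I) mxrank_add.
have:= cardsC I; rewrite card_ord.
have:= le_card I; have:= le_card (~: I); lia.
Qed.

(** * Covers and the completion theorem *)

(* [#|I| + \rank (K with rows I and columns J deleted) + #|J|], where deleting
   the columns J is replaced by adding the coordinate vectors of J to the row
   space. *)
Definition cover_rank (F : fieldType) (m : nat) (K : 'M[F]_m)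
    (I J : {set 'I_m}) : nat :=
  (#|I| + \rank (coord_proj F (~: I) *m K + coord_proj F J)%MS)%N.

(** One of the two new row spaces lies in [U1 + U2], the other in [U1 :&: U2]; the dimension formula
    for sum and intersection concludes. *)
Lemma cover_rank_submod (F : fieldType) (m : nat) (K : 'M[F]_m)
    (I1 I2 J1 J2 : {set 'I_m}) :
  (cover_rank K (I1 :&: I2) (J1 :|: J2) + cover_rank K (I1 :|: I2) (J1 :&: J2)
   <= cover_rank K I1 J1 + cover_rank K I2 J2)%N.
Proof.
rewrite /cover_rank.
set U1 := (_ + coord_proj F J1)%MS; set U2 := (_ + coord_proj F J2)%MS.
set UU := (_ + coord_proj F (J1 :|: J2))%MS.
set UI := (_ + coord_proj F (J1 :&: J2))%MS.
have sU : (UU <= U1 + U2)%MS.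
  rewrite addsmx_sub setCI; apply/andP; split.
    by rewrite (submx_trans (coord_proj_sub_setU _ _ _)) ?addsmxS ?addsmxSl.
  rewrite -[X in (X <= _)%MS]mulmx1.
  by rewrite (submx_trans (coord_proj_sub_setU _ _ _)) ?mulmx1 ?addsmxS ?addsmxSr.
have sI : (UI <= U1 :&: U2)%MS.
  rewrite sub_capmx !addsmxS // ?setCU ?coord_proj_subl ?subsetIl ?subsetIr //.
  - by rewrite -[X in (_ <= X)%MS]mulmx1 -[X in (X <= _)%MS]mulmx1
         coord_proj_subl ?subsetIr.
  by rewrite -[X in (_ <= X)%MS]mulmx1 -[X in (X <= _)%MS]mulmx1
         coord_proj_subl ?subsetIl.
have:= mxrankS sU; have:= mxrankS sI; have:= mxrank_sum_cap U1 U2.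
have:= cardsUI I1 I2; lia.
Qed.

(** A form of the nullity theorem: multiplying by [invmx K] turns the rows of [K] outside [I] into
    coordinate vectors, and projecting onto the coordinates in [I] kills exactly their span. *)
Lemma cover_rank_unit (F : fieldType) (m : nat) (K : 'M[F]_m)
    (I J : {set 'I_m}) :
  K \in unitmx ->
  cover_rank K I J = (m + \rank (coord_proj F J *m invmx K *m coord_proj F I))%N.
Proof.
move=> Ku; rewrite /cover_rank.
rewrite -(mxrankMfree _ (B := invmx K)); last by rewrite row_free_unit unitmx_inv.
rewrite addsmxMr mulmxK //.
set P := coord_proj F J *m _; set D := coord_proj F (~: I).
rewrite -(mxrank_mul_ker _ (coord_proj F I)) addsmxMr.
have -> : D *m coord_proj F I = 0 by rewrite coord_proj_mul setIC setICr coord_proj0.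
rewrite adds0mx.
have kerE : (kermx (coord_proj F I) :=: D)%MS.
  apply/eqmxP; apply/andP; split; last first.
    by apply/sub_kermxP; rewrite coord_proj_mul setIC setICr coord_proj0.
  rewrite -[X in (X <= _)%MS]mulmx1 -(coord_proj_setC F I) mulmxDr mulmx_ker add0r.
  exact: submxMl.
have -> : \rank ((D + P) :&: kermx (coord_proj F I))%MS = #|~: I|.
  rewrite (cap_eqmx (eqmx_refl _) kerE) -(rank_coord_proj F); apply/eqmx_rank.
  by rewrite capmxSr sub_capmx submx_refl addsmxSl.
by have:= cardsC I; rewrite card_ord; lia.
Qed.

(* The case [t = 1] covers the situation in which row [r] of [K] already lies in
   the space spanned by the others: then adding a coordinate vector outside that
   space moves it out. *)
Lemma cover_rank_contract (F : fieldType) (m : nat) (K : 'M[F]_m)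
    (I J : {set 'I_m}) (r c : 'I_m) :
  r \notin I ->
  exists t : F,
    (cover_rank K (r |: I) (c |: J) <= (cover_rank (K + t *: delta_mx r c) I J).+1)%N.
Proof.
move=> rI; rewrite /cover_rank cardsU1 rI add1n.
set U := (coord_proj F (~: (r |: I)) *m K + coord_proj F J)%MS.
set e : 'rV[F]_m := delta_mx 0 c.
pose U1 t := (coord_proj F (~: I) *m (K + t *: delta_mx r c) + coord_proj F J)%MS.
have sU : (coord_proj F (~: (r |: I)) *m K + coord_proj F (c |: J) <= U + e)%MS.
  rewrite addsmx_sub (submx_trans (addsmxSl _ (coord_proj F J)) (addsmxSl _ _)) /=.
  rewrite -[X in (X <= _)%MS]mulmx1 addsmxC.
  apply: submx_trans (coord_proj_sub_setU _ _ _) _.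
  apply: addsmxS; last by rewrite mulmx1 addsmxSr.
  by apply/coord_proj_subP=> i /set1P->; rewrite row1.
have sU1 t : (U + (row r K + t *: e)%R <= U1 t)%MS.
  have -> : row r K + t *: e = row r (K + t *: delta_mx r c).
    by rewrite linearD linearZ /= [row r (delta_mx _ _)]rowE mul_delta_mx.
  rewrite addsmx_sub; apply/andP; split; last first.
    by rewrite (submx_trans (row_coord_proj_sub _ (_ : r \in ~: I))) ?addsmxSl ?inE.
  have -> : U = (coord_proj F (~: (r |: I)) *m (K + t *: delta_mx r c)
                 + coord_proj F J)%MS.
    congr (_ + _)%MS; apply/matrixP=> i j; rewrite !coord_projMlE !inE negb_or.
    by case: eqVneq => //= ir; rewrite !mxE (negPf ir) mulr0 addr0.
  by apply: addsmxS => //; apply: coord_proj_subl; rewrite setCS subsetUr.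
suff [t le_t] : exists t, (\rank (U + e)%MS <= \rank (U + (row r K + t *: e)%R)%MS)%N.
  exists t; rewrite addSn ltnS leq_add2l.
  exact: leq_trans (mxrankS sU) (leq_trans le_t (mxrankS (sU1 t))).
have [wU|wU] := boolP (row r K <= U)%MS.
  exists 1; apply: mxrankS; rewrite addsmx_sub addsmxSl scale1r /=.
  rewrite -[X in (X <= _)%MS](addKr (row r K)) addmx_sub ?addsmxSr //.
  by rewrite -scaleN1r scalemx_sub // (submx_trans wU) ?addsmxSl.
(* Row [r] lies outside [U], so it alone raises the rank by one, the most that [e] can add. *)
exists 0; rewrite scale0r addr0.
have : (\rank U < \rank (U + row r K)%MS)%N.
  apply: rank_ltmx; rewrite ltmxE addsmxSl /=.
  by apply: contra wU; apply: submx_trans; apply: addsmxSr.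
have := (mxrank_adds_leqif U e).1; have := rank_leq_row e; lia.
Qed.

(* Deletion-contraction on a free position [(r, c)]: if neither leaving it at
   zero nor using it as a pivot (deleting row [r] and column [c]) gave rank [k],
   the two covers witnessing this would, by submodularity, uncross into a cover
   of [N] of value less than [k]. *)
Lemma completion_cover_rank (F : fieldType) (m : nat) (N : {set 'I_m * 'I_m})
    (K : 'M[F]_m) (I0 J0 : {set 'I_m}) (k : nat) :
  (forall I J : {set 'I_m}, I0 \subset I -> J0 \subset J ->
     (forall r c, (r, c) \in N -> (r \in I) || (c \in J)) ->
     (k <= cover_rank K I J)%N) ->
  exists2 X : 'M[F]_m, forall r c, (r, c) \notin N -> X r c = 0 &
    (k <= cover_rank (K + X) I0 J0)%N.
Proof.
have [n leNn] := ubnP #|N|; elim: n => // n IHn in N leNn I0 J0 k *.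
move=> hN.
have [/existsP[r /existsP[c /and3P[Nrc rI0 cJ0]]]|noN] :=
  boolP [exists r, exists c, [&& (r, c) \in N, r \notin I0 & c \notin J0]]; last first.
  (* Every free position already meets [I0] or [J0], so this pair is itself a cover. *)
  exists 0; first by move=> *; rewrite mxE.
  rewrite addr0 hN // => r c Nrc; apply: contraR noN; rewrite negb_or => rcN.
  by apply/existsP; exists r; apply/existsP; exists c; rewrite Nrc.
pose N' := N :\ (r, c).
have ltN'n : (#|N'| < n)%N by move: leNn; rewrite (cardsD1 (r, c)) Nrc add1n ltnS.
have sN'N (X : 'M[F]_m) : (forall i j, (i, j) \notin N' -> X i j = 0) ->
    forall i j, (i, j) \notin N -> X i j = 0.
  by move=> X0 i j Nij; rewrite X0 // !inE (negPf Nij) andbF.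
pose small (k : nat) (I0 J0 I J : {set 'I_m}) :=
  [&& I0 \subset I, J0 \subset J,
    [forall i, forall j, ((i, j) \in N') ==> (i \in I) || (j \in J)] &
    (cover_rank K I J < k)%N].
have smallPn k' I0' J0' : ~~ [exists I, exists J, small k' I0' J0' I J] ->
    exists2 X : 'M[F]_m, forall i j, (i, j) \notin N' -> X i j = 0 &
      (k' <= cover_rank (K + X) I0' J0')%N.
  move=> no_small; apply: IHn => // I J sI sJ cov; rewrite leqNgt.
  apply: contra no_small => lt_k.
  apply/existsP; exists I; apply/existsP; exists J; apply/and4P; split => //.
  by apply/forallP=> i; apply/forallP=> j; apply/implyP=> /cov.
have [/existsP[I1 /existsP[J1 /and4P[sI1 sJ1 /forallP cov1 lt1]]]|] :=
  boolP [exists I, exists J, small k I0 J0 I J]; last first.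
  by case/smallPn => X /sN'N; exists X.
have [/existsP[I2 /existsP[J2 /and4P[sI2 sJ2 /forallP cov2 lt2]]]|] :=
  (* The target is [k.+1] because [cover_rank_contract] loses one. *)
  boolP [exists I, exists J, small k.+1 (r |: I0) (c |: J0) I J]; last first.
  case/smallPn => X X0; have [t le_t] := cover_rank_contract (K + X) J0 c rI0.
  move=> le_k; exists (X + t *: delta_mx r c); last first.
    by rewrite addrA -ltnS (leq_trans le_k).
  move=> i j Nij; rewrite !mxE (sN'N X) // add0r.
  case: eqP => [ir|]; last by rewrite mulr0.
  case: eqP => [jc|]; last by rewrite mulr0.
  by move: Nij; rewrite ir jc Nrc.
move: sI2 sJ2; rewrite !subUset !sub1set => /andP[rI2 sI2] /andP[cJ2 sJ2].
(* The position [(r, c)], absent from [N'], is covered both times because [r] is in [I2] and [c] in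
   [J2]. *)
have cover i j : (i, j) \in N ->
    ((i \in I1 :&: I2) || (j \in J1 :|: J2)) && ((i \in I1 :|: I2) || (j \in J1 :&: J2)).
  move=> Nij; rewrite !inE.
  have [/eqP[-> ->]|ne] := boolP ((i, j) == (r, c)).
    by rewrite rI2 cJ2 !orbT.
  have N'ij : (i, j) \in N' by rewrite !inE ne.
  have /forallP/(_ j) := cov1 i; have /forallP/(_ j) := cov2 i.
  rewrite N'ij /=.
  by case: (i \in I1); case: (i \in I2); case: (j \in J1); case: (j \in J2).
have le1 : (k <= cover_rank K (I1 :&: I2) (J1 :|: J2))%N.
  apply: hN => [||i j /cover/andP[]//].
    by rewrite subsetI sI1.
  by rewrite (subset_trans sJ1) ?subsetUl.
have le2 : (k <= cover_rank K (I1 :|: I2) (J1 :&: J2))%N.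
  apply: hN => [||i j /cover/andP[]//].
    by rewrite (subset_trans sI1) ?subsetUl.
  by rewrite subsetI sJ1.
(* The two covers have values at most [k - 1] and [k], the uncrossed ones at least [k] each. *)
have := cover_rank_submod K I1 I2 J1 J2; lia.
Qed.

(** * Invertibility from a height, rank truncation, minima *)

(** A left kernel vector satisfies [v = v *m A], so its entries vanish by induction on the
    height. *)
Lemma unitmx_sub_height (F : fieldType) (m : nat) (A : 'M[F]_m)
    (h : 'I_m -> nat) :
  (forall i j, A i j != 0 -> (h i < h j)%N) -> 1%:M - A \in unitmx.
Proof.
move=> hA; rewrite -row_free_unit; apply: inj_row_free => v.
rewrite mulmxBr mulmx1 => /subr0_eq vE.
suff v0 n j : (h j < n)%N -> v 0 j = 0.
  by apply/rowP=> j; rewrite mxE (v0 (h j).+1).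
elim: n j => // n IHn j hj; rewrite vE mxE big1 // => i _.
have [->|/hA hij] := eqVneq (A i j) 0; first by rewrite mulr0.
by rewrite IHn ?mul0r //; lia.
Qed.

(** Changes of basis bring [P] to a partial identity, which is then truncated to size [k]. *)
Lemma exists_rank_mul (F : fieldType) (m n p q k : nat) (P : 'M[F]_(m, n)) :
  (k <= \rank P)%N -> (k <= p)%N -> (k <= q)%N ->
  exists (A : 'M[F]_(p, m)) (B : 'M[F]_(q, n)), \rank (A *m P *m B^T) = k.
Proof.
move=> kP kp kq.
exists (pid_mx k *m invmx (col_ebase P)), ((invmx (row_ebase P) *m pid_mx k)^T).
rewrite trmxK -{2}(mulmx_ebase P) !mulmxA mulmxKV ?col_ebase_unit //.
rewrite -[X in X *m pid_mx k]mulmxA mulmxV ?row_ebase_unit // mulmx1 !mul_pid_mx.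
have := rank_leq_row P; have := rank_leq_col P => Pn Pm.
rewrite (_ : minn _ _ = k) ?rank_pid_mx //; lia.
Qed.

Lemma geq_bigminn (I : finType) (P : pred I) (f : I -> nat) (d : nat) i :
  P i -> (\big[minn/d]_(j | P j) f j <= f i)%N.
Proof.
move=> Pi; have := mem_index_enum i; elim: (index_enum I) => // x s IHs.
rewrite inE big_cons => /orP[/eqP <-|/IHs le_s]; first by rewrite Pi geq_minl.
by case: ifP => // _; rewrite geq_min le_s orbT.
Qed.

(** * Networks: every cut bounds the rank *)

Section Network.

Variables (F : fieldType) (V : finType) (m mu nu : nat).
Variables (own : 'I_m -> V) (isout : 'I_m -> bool) (E : rel 'I_m) (S T : V).
Hypotheses (hE : adt_edges_ok own isout E) (hacyc : adt_acyclic own E).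

(** Supernodes are ranked by their number of ancestors. Doubling leaves room to place the outputs of
    a supernode above its inputs and still below the inputs of its successors. *)
Definition port_height (i : 'I_m) : nat :=
  (#|[set u | connect (adt_node_rel own E) u (own i)]|.*2 + isout i)%N.

Lemma port_height_lt (beta : 'M[F]_m) i j :
  adt_F own isout E beta i j != 0 -> (port_height i < port_height j)%N.
Proof.
rewrite mxE /port_height; case: ifP => [Eij _|_].
  have /and3P[-> /negPf-> _] := hE Eij.
  have R : adt_node_rel own E (own i) (own j).
    by apply/existsP; exists i; apply/existsP; exists j; rewrite Eij !eqxx.
  suff /proper_card : [set u | connect (adt_node_rel own E) u (own i)]
     \proper [set u | connect (adt_node_rel own E) u (own j)] by lia.
  apply/properP; split.
    apply/subsetP=> u; rewrite !inE => /connect_trans; apply; exact: connect1.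
  by exists (own j); rewrite !inE ?connect0 // hacyc.
by case: ifP => [/and3P[/negPf-> -> /eqP->] _|]; rewrite ?eqxx // addn0 addn1.
Qed.

Lemma adt_AE (alpha : 'M[F]_(mu, m)) :
  adt_A own isout S alpha
  = alpha *m coord_proj F [set j | isout j && (own j == S)].
Proof. by apply/matrixP=> i j; rewrite coord_projMrE mxE inE. Qed.

Lemma adt_BE (eps : 'M[F]_(nu, m)) :
  adt_B own isout T eps
  = eps *m coord_proj F [set j | ~~ isout j && (own j == T)].
Proof. by apply/matrixP=> i j; rewrite coord_projMrE mxE inE. Qed.

(* With [P], [Q] the projections onto the ports inside and outside [Om], the
   signal [y = x A (1 - F)^-1] satisfies [y Q (1 - Q F Q) = y G_Om], so that the
   signal outside of [Om] is determined by [y G_Om]. *)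
Lemma rank_adt_M_le_cut (Om : {set V}) alpha (beta : 'M[F]_m) eps :
  S \in Om -> T \notin Om ->
  (\rank (adt_M own isout E S T alpha beta eps : 'M_(mu, nu))
   <= \rank (adt_GOmega F own isout E Om))%N.
Proof.
move=> SOm TOm; rewrite /adt_M.
set A := adt_A _ _ _ _; set B := adt_B _ _ _ _; set Fb := adt_F _ _ _ _.
set G := adt_GOmega _ _ _ _ _.
pose P := coord_proj F [set i | own i \in Om].
pose Q := coord_proj F (~: [set i | own i \in Om]).
have PQ : P + Q = 1%:M by apply: coord_proj_setC.
have AQ : A *m Q = 0.
  rewrite /A adt_AE -mulmxA coord_proj_mul -[RHS](mulmx0 _ alpha); congr (_ *m _).
  apply/matrixP=> i j; rewrite coord_projE mxE !inE.
  by case: (own i =P S) => [->|_]; rewrite ?SOm ?andbF.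
have QB : Q *m B^T = B^T.
  apply/matrixP=> i j; rewrite coord_projMlE !mxE !inE.
  by case: (own i =P T) => [->|_]; rewrite ?(negPf TOm) ?andbF // if_same.
(* The [beta] entries stay within one supernode, so only edges cross the cut. *)
have GE : P *m Fb *m Q = G.
  apply/matrixP=> i j; rewrite coord_projMrE coord_projMlE !mxE !inE.
  have := @hE i j; case: (E i j) => [/(_ isT)/and3P[-> -> _]|_].
    by case: (own i \in Om); case: (own j \in Om).
  case: (own i =P own j) => [->|_]; last by rewrite !andbF !if_same.
  by case: (own j \in Om).
have Fu : 1%:M - Fb \in unitmx by apply: unitmx_sub_height (port_height_lt (beta := beta)).
have QFu : 1%:M - Q *m Fb *m Q \in unitmx.
  apply: (unitmx_sub_height (h := port_height)) => i j.
  rewrite coord_projMrE coord_projMlE.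
  by do 2![case: ifP; rewrite ?eqxx // => _]; apply: port_height_lt.
have ANQ : A *m invmx (1%:M - Fb) *m Q *m (1%:M - Q *m Fb *m Q)
    = A *m invmx (1%:M - Fb) *m G.
  set N := A *m invmx _.
  have NF : N *m Q = N *m Fb *m Q.
    apply/eqP; rewrite -subr_eq0 -mulmxBl -[X in X - _]mulmx1 -mulmxBr.
    by rewrite /N mulmxKV // AQ.
  rewrite mulmxBr mulmx1 -GE {1}NF -[X in X *m Fb *m Q]mulmx1 -PQ.
  have QQ : Q *m Q = Q by rewrite coord_proj_mul setIid.
  by rewrite !mulmxA -[N *m Q *m Q]mulmxA QQ mulmxDr !mulmxDl addrK.
rewrite -QB mulmxA -[A *m _ *m Q](mulmxK QFu) ANQ.
rewrite -!mulmxA mulmxA.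
exact: leq_trans (mxrankM_maxr _ _) (mxrankM_maxl _ _).
Qed.

(** * Coefficients attaining the minimal cut *)

Lemma adt_mincut_achieved :
  (adt_mincut F own isout E S T <= mu)%N ->
  (adt_mincut F own isout E S T <= nu)%N ->
  S != T ->
  exists alpha beta eps,
  \rank (adt_M own isout E S T alpha beta eps : 'M[F]_(mu, nu))
  = adt_mincut F own isout E S T.
Proof.
set k := adt_mincut _ _ _ _ _ _ => kmu knu hST.
pose Em : 'M[F]_m := \matrix_(i, j) (E i j)%:R.
(* Edges go from outputs to inputs, so no two compose; hence [1 + Em] inverts [1 - Em]. *)
have EE : Em *m Em = 0.
  apply/matrixP=> i j; rewrite !mxE big1 // => l _; rewrite !mxE.
  have := @hE i l; have := @hE l j.
  case: (E i l); last by rewrite mul0r.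
  case: (E l j); last by rewrite mulr0.
  by move=> /(_ isT)/and3P[-> _ _] /(_ isT)/and3P[].
have KE : (1%:M - Em) *m (1%:M + Em) = 1%:M.
  by rewrite mulmxDr mulmx1 mulmxBl mul1mx EE subr0 subrK.
have [Ku _] := mulmx1_unit KE.
have invK : invmx (1%:M - Em) = 1%:M + Em by rewrite -[RHS](mulKmx Ku) KE mulmx1.
pose N := [set p : 'I_m * 'I_m | [&& ~~ isout p.1, isout p.2 & own p.1 == own p.2]].
pose I0 := [set i | ~~ isout i && (own i == T)].
pose J0 := [set j | isout j && (own j == S)].
have [|X X0] := @completion_cover_rank F m N (1%:M - Em) I0 J0 (m + k).
  move=> I J /subsetP sI /subsetP sJ cov.
  rewrite cover_rank_unit // invK leq_add2l.
  (* A supernode outside [Om] other than [T] has an output not in [J], so the cover must contain all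
     of its inputs in [I]. *)
  pose Om := [set v | (v != T) && [forall j, isout j && (own j == v) ==> (j \in J)]].
  have SOm : S \in Om.
    rewrite inE hST; apply/forallP=> j; apply/implyP=> hj.
    by apply: sJ; rewrite inE.
  have TOm : T \notin Om by rewrite inE eqxx.
  have outJ i : isout i -> own i \in Om -> i \in J.
    by move=> oi; rewrite inE => /andP[_ /forallP/(_ i)]; rewrite oi eqxx.
  have inI j : ~~ isout j -> own j \notin Om -> j \in I.
    move=> ij; rewrite inE negb_and negbK => /orP[jT|].
      by apply: sI; rewrite inE ij.
    case/forallPn=> l; rewrite negb_imply => /andP[/andP[ol /eqP lj] lJ].
    by have := cov j l; rewrite inE /= ij ol lj eqxx (negPf lJ) orbF; apply.
  clearbody Om.
  have le_cut : (k <= \rank (adt_GOmega F own isout E Om))%N.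
    apply: (geq_bigminn (P := fun W : {set V} => (S \in W) && (T \notin W))).
    by rewrite SOm.
  apply: leq_trans le_cut _.
  (* [G_Om] is a block of [1 + Em] with rows in [J] and columns in [I]; the diagonal is not seen,
     since the rows are outputs and the columns inputs. *)
  have -> : adt_GOmega F own isout E Om =
    coord_proj F [set i | isout i && (own i \in Om)] *m
    (coord_proj F J *m (1%:M + Em) *m coord_proj F I) *m
    coord_proj F [set j | ~~ isout j && (own j \notin Om)].
    apply/matrixP=> i j; rewrite 2!(coord_projMrE, coord_projMlE).
    rewrite coord_projMrE coord_projMlE !mxE !inE.
    have := @inI j; have := @outJ i; case: eqP => [->|_].
      by case: (isout j); rewrite /= ?andbF ?if_same.
    rewrite add0r; case: (isout i); case: (isout j); case: (own i \in Om);
      case: (own j \in Om); rewrite /= ?andbF ?if_same // => -> // -> //.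
    by case: (E i j).
  exact: leq_trans (mxrankM_maxl _ _) (mxrankM_maxr _ _).
have -> : 1%:M - Em + X = 1%:M - adt_F own isout E (- X).
  rewrite -addrA; congr (_ + _); apply/matrixP=> i j; rewrite !mxE.
  have := X0 i j; rewrite inE /=; have := @hE i j.
  case: (E i j) => [/(_ isT)/and3P[-> _ _] ->//|_]; first by rewrite addr0.
  by case: ifP => [_ _|_ ->//]; rewrite ?opprK oppr0 ?add0r.
rewrite cover_rank_unit ?leq_add2l; last first.
  exact: unitmx_sub_height (port_height_lt (beta := - X)).
move=> le_k; have [alpha [eps rk]] := exists_rank_mul le_k kmu knu.
exists alpha, (- X), eps; rewrite -{}rk; congr (\rank _).
by rewrite /adt_M adt_AE adt_BE trmx_mul tr_diag_mx !mulmxA.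
Qed.

End Network.

Theorem theorem2 (F : finFieldType) (V : finType) (m mu nu : nat)
  (own : 'I_m -> V) (isout : 'I_m -> bool) (E : rel 'I_m) (S T : V)
  (hE : adt_edges_ok own isout E) (hacyc : adt_acyclic own E)
  (hST : S != T)
  (hmu : (adt_mincut F own isout E S T <= mu)%N)
  (hnu : (adt_mincut F own isout E S T <= nu)%N) :
  adt_mincut F own isout E S T =
  (\max_(alpha : 'M[F]_(mu, m)) \max_(beta : 'M[F]_m)
     \max_(eps : 'M[F]_(nu, m))
       \rank (adt_M own isout E S T alpha beta eps))%N.
Proof.
apply/eqP; rewrite eqn_leq; apply/andP; split.
  have [alpha [beta [eps <-]]] := adt_mincut_achieved hE hacyc hmu hnu hST.
  by rewrite (bigmax_sup alpha) // (bigmax_sup beta) // (bigmax_sup eps).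
apply/bigmax_leqP => alpha _; apply/bigmax_leqP => beta _.
apply/bigmax_leqP => eps _; rewrite /adt_mincut.
elim/big_ind: _ => [|x y hx hy|Om /andP[SOm TOm]].
(* The default [m] of the minimum is also a bound, as [M] factors through dimension [m]. *)
- rewrite /adt_M -mulmxA; apply: leq_trans (mxrankM_maxl _ _) _.
  exact: rank_leq_col.
- by rewrite leq_min hx.
exact: rank_adt_M_le_cut.
Qed.
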